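(* Let $n,r,m\in\mathbb{N}$ with $\omega(n)=m$. Then: (1) for every integer $k\ge 6$, $$\mathsf{s}_{kn}(C_n^3)\le (k+3)n+a_3 n^{1-\frac1m};$$ (2) for every integer $k\ge 18$, $$\mathsf{s}_{kn}(C_n^4)\le (k+4)n+a_4 n^{1-\frac1m};$$ (3) for every $k\in\mathbb{N}$ and fixed $r\ge 5$, $$\mathsf{s}_{k\mathsf{p}(n,r)n}(C_n^r)\le (k\,\mathsf{p}(n,r)+r)n+a_r n^{1-\frac1m}.$$
   Context: $\mathbb{N}$ denotes the positive integers; $\omega(n)$ is the number of distinct prime divisors of $n$. $C_n$ is the cyclic group of order $n$ and $C_n^r$ is the direct sum of $r$ copies of it (exponent $n$). A sequence over a finite abelian group $G$ is a finite unordered sequence of elements of $G$ with repetition allowed; its length is the number of terms counted with multiplicity, a subsequence is a sub-multiset, and a sequence is zero-sum if its terms sum to $0$. For a finite abelian group $G$ with exponent $e$ and $k\in\mathbb{N}$, $\mathsf{s}_{ke}(G)$ is the smallest positive integer $t$ such that every sequence over $G$ of length at least $t$ has a zero-sum subsequence of length exactly $ke$; $\mathsf{s}(G)=\mathsf{s}_e(G)$. For $n\ge 2$, $\mathsf{M}(n)$ is the largest prime power divisor of $n$. If $\mathsf{M}(n)=p^a$ with $p$ prime, then $\mathsf{p}(n,r)=\min\{p^t : t\in\mathbb{N},\ p^t\ge r\}$. Constant $a_r$: by a theorem of Alon and Dubiner there is an absolute constant $c>0$ such that $\mathsf{s}(C_n^r)\le (cr\log_2 r)^r n$ for all $n\in\mathbb{N}$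 and $r\ge 2$. Fix such a $c$ and put $a_r=(cr\log_2 r)^r-r$. *)

(* Defs.v *)
From mathcomp Require Export all_boot all_order all_algebra all_fingroup all_solvable.
From mathcomp Require Export finmap multiset.
From mathcomp Require Export boolp classical_sets reals exp.

Set Implicit Arguments.
Unset Strict Implicit.
Unset Printing Implicit Defensive.

Import Order.TTheory GRing.Theory Num.Theory.
Local Open Scope mset_scope.
Local Open Scope nat_scope.

(* Minimum of a set of naturals, with value 0 on the empty set. *)
Definition least (A : set nat) : nat :=
  xget 0 [set t | A t /\ forall u, A u -> t <= u].

Lemma leastP (A : set nat) : (exists t, A t) ->
  A (least A) /\ forall u, A u -> least A <= u.
Proof.
move=> [t At]; rewrite /least; case: xgetP => // noA; exfalso.
have exA : exists u, `[< A u >] by exists t; apply/asboolP.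
case: (ex_minnP exA) => u /asboolP Au minu.
by apply: (noA u); split=> // v Av; apply: minu; apply/asboolP.
Qed.

Section ZeroSum.
Variable G : finZmodType.

(* Sequences over G are unordered, hence multisets; [size] counts terms with
   multiplicity. *)
Definition has_zero_sum_subseq (l : nat) (S : {mset G}) : Prop :=
  exists T : {mset G},
    [/\ (T `<=` S)%mset, size T = l & (\sum_(x <- T) x = 0)%R].

(* [exponent] refers to the additive group structure of G. *)
Definition s_set (k : nat) : set nat :=
  [set t | 0 < t /\ forall S : {mset G}, t <= size S ->
     has_zero_sum_subseq (k * exponent [set: G]) S].

Definition s_const (k : nat) : nat := least (s_set k).

Lemma s_set_neq0 (k : nat) : exists t, s_set k t.
Proof.
pose e := exponent [set: G]; exists (#|G| * (k * e)).+1; split=> // S leS.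
have [g gS] : exists g, k * e <= S g.
  apply: contrapT => noS; move: leS; rewrite ltnNge => /negP; apply.
  rewrite -sum1_size.
  have -> : \sum_(x <- S) 1 = \sum_(g : G) S g.
    rewrite sum1_size -(count_predT S).
    transitivity (\sum_(g : G) count_mem g S); last first.
      by apply: eq_bigr => g _; rewrite count_mem_mset.
    elim: (enum_mset S) => [|x s IHs] /=; first by rewrite big1.
    rewrite big_split /= -IHs; congr (_ + _).
    rewrite (bigD1 x) //= eqxx big1 // => g /negPf gx.
    by rewrite eq_sym gx.
  rewrite -sum_nat_const; apply: leq_sum => g _.
  by rewrite leqNgt; apply/negP => h; apply: noS; exists g; apply: ltnW.
exists (msetn (k * e) g); split.
- by apply/msubsetP => x; rewrite msetnE; case: eqP => // ->.
- by rewrite enum_msetn size_nseq.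
rewrite big_msetn Monoid.iteropE -/(GRing.natmul _ _).
have eg : (g *+ e = 0)%R.
  by rewrite -FinRing.zmodXgE; apply: expg_exponent; rewrite inE.
suff -> : iter (k * e) (+%R g) 0%R = (g *+ (k * e))%R.
  by rewrite mulnC mulrnA eg mul0rn.
by elim: (k * e) => //= i ->; rewrite mulrS.
Qed.

Lemma s_constP (k : nat) :
  s_set k (s_const k) /\ forall u, s_set k u -> s_const k <= u.
Proof. exact/leastP/s_set_neq0. Qed.

End ZeroSum.

(* For 0 < n, 'I_n.-1.+1 is Z/n as an additive group; n = 1 gives the trivial
   group, where 'Z_n would be Z/2. *)
Definition cyclic_pow (n r : nat) : finZmodType := 'rV['I_n.-1.+1]_r.

Lemma exponent_cyclic_pow (n r : nat) : 0 < n -> 0 < r ->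
  exponent [set: cyclic_pow n r] = n.
Proof.
case: n => // n _; case: r => // r _.
have natE (a : 'I_n.+1) k : (a *+ k)%R = k * a %% n.+1 :> nat.
  elim: k => [|k IHk]; first by rewrite mul0n mod0n.
  by rewrite mulrS /= IHk modnDmr mulSn.
apply/eqP; rewrite eqn_dvd; apply/andP; split.
  apply/exponentP => x _; rewrite FinRing.zmodXgE; apply/rowP => j.
  apply: val_inj; rewrite mulmxnE mxE.
  by apply: etrans (natE (x ord0 j) n.+1) _; rewrite modnMr.
pose u : cyclic_pow n.+1 r.+1 := const_mx (inZp 1).
have := expg_exponent (finset.in_setT u); rewrite FinRing.zmodXgE => /rowP /(_ ord0).
rewrite mulmxnE !mxE => /(congr1 val) ue.
have := etrans (esym (natE (inZp 1) _)) ue.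
by rewrite /= modnMmr muln1 => /eqP.
Qed.

Definition omega (n : nat) : nat := size (primes n).

Definition prime_power (q : nat) : Prop :=
  exists p a, [/\ prime p, 0 < a & q = p ^ a].

Definition max_prime_power (n : nat) : nat :=
  \max_(q <- divisors n | `[< prime_power q >]) q.

(* p(n, r); meaningful for 2 <= n. *)
Definition p_const (n r : nat) : nat :=
  least [set q | exists p a t, [/\ prime p, max_prime_power n = p ^ a,
                                   0 < t, q = p ^ t & r <= q]].

Lemma p_const_exists (n r : nat) : 1 < n ->
  exists q p a t, [/\ prime p, max_prime_power n = p ^ a,
                      0 < t, q = p ^ t & r <= q].
Proof.
move=> n1.
have [p [a [pp _ ea]]] : prime_power (max_prime_power n).
  have d0 : pdiv n \in divisors n by rewrite -dvdn_divisors ?pdiv_dvd // ltnW.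
  have P0 : `[< prime_power (pdiv n) >].
    by apply/asboolP; exists (pdiv n), 1; rewrite pdiv_prime // expn1.
  rewrite /max_prime_power -big_filter.
  have : pdiv n \in [seq q <- divisors n | `[< prime_power q >]].
    by rewrite mem_filter P0.
  have : {in [seq q <- divisors n | `[< prime_power q >]],
           forall q, prime_power q}.
    by move=> q; rewrite mem_filter => /andP[/asboolP].
  elim: [seq _ <- _ | _] {d0 P0} (pdiv n) => // x s IHs y Ps ys.
  rewrite big_cons; have Px : prime_power x by apply: Ps; rewrite mem_head.
  case: s IHs Ps {ys} => [|z s] IHs Ps; first by rewrite big_nil maxn0.
  rewrite /maxn; case: ifP => // _; apply: (IHs z); rewrite ?mem_head //.
  by move=> q qs; apply: Ps; rewrite inE qs orbT.
exists (p ^ r.+1), p, a, r.+1; split=> //.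
by apply: ltnW; apply: ltn_trans (ltn_expl _ (prime_gt1 pp)).
Qed.

Local Open Scope ring_scope.

Definition log2 (R : realType) (x : R) : R := ln x / ln 2.

Definition alon_dubiner_constant (R : realType) (c : R) : Prop :=
  0 < c /\ forall n r : nat, (0 < n)%N -> (2 <= r)%N ->
    (s_const (cyclic_pow n r) 1)%:R <= (c * r%:R * log2 r%:R) ^+ r * n%:R.

(* a_r, for the chosen constant c. *)
Definition a_const (R : realType) (c : R) (r : nat) : R :=
  (c * r%:R * log2 r%:R) ^+ r - r%:R.

(* Main.v *)
Require Import Defs.
From mathcomp Require Import zify ring.
Import Order.TTheory GRing.Theory Num.Theory.
Local Open Scope ring_scope.

(** Write [n = q n'] with [q] the largest prime power divisor of [n]. Over [C_n'],
    one extracts from a long sequence many blocks of length [n'] whose sums lie in a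
    copy of [C_q^r]; so it is enough to know that every sequence over [C_q^r] of
    length at least [(k + r) q - r] has a zero-sum subsequence of length [k q]
    ([good q r k]), a property that is additive in [k].

    For [q] a power of [p], a function of degree less than the length of a sequence
    has vanishing alternating sum over its subsequences. Applied to the indicator of
    [0] in [C_q^r], of degree [r (q - 1)], times [H (length / q)], this shows: if
    [H : nat -> F_p] has degree less than [L - r] and [H 0 <> 0], then a sequence of
    length at least [L q - r] has a zero-sum subsequence of some length [j q] with
    [0 < j < L] and [H j <> 0]. Taking for [H] the indicator of the multiples of
    [p ^ t >= r] gives [good q r (p ^ t)], hence part (3). For [p >= 5], products
    [H j = \prod_(a <- A) (a - j)] together with passing to subsequences and to
    complements give [good q 3 3], [good q 3 4], [good q 4 4] and [good q 4 5]. For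
    [p = 2] and [p = 3], sequences of length greater than [A (q - 1)], with [A = 2 ^ r]
    or the maximal size of a cap in [F_3 ^ r] ([A <= 9, 21] for [r = 3, 4], by
    Meshulam's argument), have a zero-sum subsequence of length [q], so that
    [good q r k] implies [good q r k.+1] for large [k]. *)

Set Implicit Arguments.
Unset Strict Implicit.
Unset Printing Implicit Defensive.

(** * Polynomial maps and zero-sum subsequences *)

Section Difference.
Variables (M : nmodType) (R : comNzRingType).
Implicit Types (f g : M -> R) (u v x : M).

Definition diff u f x : R := f (x + u) - f x.

(* [deg_lt d f]: [f] is a polynomial map of degree less than [d]. *)
Fixpoint deg_lt (d : nat) f : Prop :=
  if d is e.+1 then forall u, deg_lt e (diff u f) else forall x, f x = 0.

Lemma deg_lt_ext d f g : f =1 g -> deg_lt d f -> deg_lt d g.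
Proof.
elim: d f g => [|d IHd] f g eqfg /= df; first by move=> x; rewrite -eqfg.
by move=> u; apply: IHd (df u) => x; rewrite /diff !eqfg.
Qed.

Lemma deg_lt0 d : deg_lt d (fun=> 0).
Proof.
elim: d => //= d IHd u; apply: deg_lt_ext IHd => x.
by rewrite /diff subrr.
Qed.

Lemma deg_ltS d f : deg_lt d f -> deg_lt d.+1 f.
Proof.
elim: d f => [|d IHd] f df u; last exact/IHd/df.
by move=> x; rewrite /diff !df subrr.
Qed.

Lemma deg_ltW d e f : (d <= e)%N -> deg_lt d f -> deg_lt e f.
Proof.
move=> /subnK <-; elim: (e - d)%N => // n IHn df.
by apply: deg_ltS; apply: IHn.
Qed.

Lemma deg_ltD d f g : deg_lt d f -> deg_lt d g -> deg_lt d (fun x => f x + g x).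
Proof.
elim: d f g => [|d IHd] f g /= df dg; first by move=> x; rewrite df dg addr0.
move=> u; apply: deg_lt_ext (IHd _ _ (df u) (dg u)) => x.
by rewrite /diff; ring.
Qed.

Lemma deg_lt_shift d f v : deg_lt d f -> deg_lt d (fun x => f (x + v)).
Proof.
elim: d f => [|d IHd] f /= df; first by move=> x.
move=> u; apply: deg_lt_ext (IHd _ (df u)) => x.
by rewrite /diff addrAC.
Qed.

Lemma deg_lt_cst (c : R) : deg_lt 1 (fun=> c).
Proof. by move=> u x; rewrite /diff subrr. Qed.

(** Discrete Leibniz rule: the difference of f g is [diff u f] times a shift of g plus f times
    [diff u g], and one degree drops in each product. *)
Lemma deg_ltM d e f g : deg_lt d.+1 f -> deg_lt e.+1 g ->
  deg_lt (d + e)%N.+1 (fun x => f x * g x).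
Proof.
have [n] := ubnP (d + e)%N; elim: n => // n IHn in d e f g *.
move=> ltn df dg u.
apply: (@deg_lt_ext _ (fun x => diff u f x * g (x + u) + f x * diff u g x)).
  by move=> x; rewrite /diff; ring.
apply: deg_ltD.
- case: d ltn df => [|d] ltn df.
    by apply: deg_lt_ext (deg_lt0 _) => x; rewrite (df u) mul0r.
  by apply: IHn (df u) (deg_lt_shift u dg); lia.
- case: e ltn dg => [|e] ltn dg.
    by apply: deg_lt_ext (deg_lt0 _) => x; rewrite (dg u) mulr0.
  by rewrite -[Nat.add _ _]/(d + e.+1)%N addnS; apply: IHn df (dg u); lia.
Qed.

Lemma deg_lt_prod (I : Type) (s : seq I) d (F : I -> M -> R) :
  (forall i, deg_lt d.+1 (F i)) ->
  deg_lt (size s * d)%N.+1 (fun x => \prod_(i <- s) F i x).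
Proof.
move=> dF; elim: s => [|i s IHs].
  by apply: deg_lt_ext (deg_lt_cst 1) => x; rewrite big_nil.
rewrite /= mulSn; apply: deg_lt_ext (deg_ltM (dF i) IHs) => x.
by rewrite big_cons.
Qed.

(* The iterated difference along [s] is the alternating sum of [f] over
   subsequences of [s]; it vanishes once [deg f < size s]. *)
Lemma deg_lt_eq0 (s : seq M) f : deg_lt (size s) f ->
  (forall m, size m = size s -> true \in m ->
     f (\sum_(x <- mask m s) x) = 0) -> f 0 = 0.
Proof.
elim: s f => [|u s IHs] f /= df f0; first exact: df.
have fu : f u = 0.
  have := f0 (true :: nseq (size s) false).
  by rewrite /= size_nseq mask_false big_seq1 mem_head; apply.
have : diff u f 0 = 0.
  apply: IHs => // m szm mt; rewrite /diff.
  have := f0 (true :: m); rewrite /= big_cons szm mem_head addrC => -> //.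
  by have := f0 (false :: m); rewrite /= szm in_cons mt => -> //; rewrite subrr.
by rewrite /diff add0r fu sub0r => /eqP; rewrite oppr_eq0 => /eqP.
Qed.

End Difference.

Section Cyclic.
Variables (M : nmodType) (R : comNzRingType).
Implicit Types (f g : M -> R) (u v x : M).

Lemma deg_lt_comp (N : nmodType) (h : N -> M) d f :
  {morph h : x y / x + y} -> deg_lt d f -> deg_lt d (f \o h).
Proof.
move=> hD; elim: d f => [|d IHd] f /= df; first by move=> x; rewrite df.
move=> u; apply: deg_lt_ext (IHd _ (df (h u))) => x.
by rewrite /diff /= hD.
Qed.

(* With [E f x = f (x + u)], one has [diff u = E - 1], and [(E - 1) ^+ q = E ^+ q - 1]
   in characteristic p. *)
Lemma iter_diff_pchar q u f : [pchar R].-nat q ->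
  iter q (diff u) f =1 diff (u *+ q) f.
Proof.
(* [lam P] is the polynomial P in the shift operator E, applied to f. *)
move=> pq x; pose lam (P : {poly R}) y := \sum_(i < size P) P`_i * f (y + u *+ i).
have lamE (P : {poly R}) m y : (size P <= m)%N ->
    lam P y = \sum_(i < m) P`_i * f (y + u *+ i).
  move=> /subnKC <-; rewrite big_split_ord /= [X in _ + X]big1 ?addr0 // => i _.
  by rewrite nth_default ?mul0r // leq_addr.
have lamX P y : lam (('X - 1) * P) y = diff u (lam P) y.
  rewrite /diff (lamE _ (size P).+1); last first.
    by apply: leq_trans (size_polyMleq _ _) _; rewrite -polyC1 size_XsubC.
  rewrite (lamE P (size P).+1 y) // /lam.
  under eq_bigr do rewrite mulrBl mul1r coefB mulrBl.
  rewrite sumrB; congr (_ - _).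
  rewrite big_ord_recl coefXM eqxx mul0r add0r; apply: eq_bigr => i _.
  by rewrite coefXM /= mulrS addrA.
have -> : iter q (diff u) f x = lam (('X - 1) ^+ q) x.
  elim: q x {pq} => [|q IHq] x; last by rewrite exprS lamX /= /diff !IHq.
  by rewrite expr0 /lam size_poly1 big_ord1 coef1 mul1r mulr0n addr0.
have pP : [pchar {poly R}].-nat q.
  by apply: sub_in_pnat pq => r _; rewrite pchar_poly.
have q0 : q != 0 by rewrite -lt0n; case/andP: pq.
rewrite exprDn_pchar // exprNn_pchar // expr1n (lamE _ q.+1); last first.
  by rewrite -polyC1 size_XnsubC ?lt0n.
case: q q0 {pq pP} => // q _; rewrite big_ord_recr big_ord_recl big1 => [|i _].
  by rewrite !coefB !coefXn !coef1 /= eqxx !(sub0r, subr0) mulN1r mul1r mulr0n !addr0 addrC.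
by rewrite coefB coefXn coef1 /= eqSS ltn_eqF // subrr mul0r.
Qed.

(** Differences along the generator u suffice: the one along [u *+ n] telescopes into shifts of the
    one along u. *)
Lemma deg_lt_cyclic d e u f : (forall x, exists n, x = u *+ n) ->
  deg_lt e (iter d (diff u) f) -> deg_lt (d + e) f.
Proof.
move=> uM; elim: d f => [|d IHd] f //.
rewrite iterSr => /IHd df v; have [n ->] := uM v.
elim: n => [|n IHn].
  by apply: deg_lt_ext (deg_lt0 _ _ _) => x; rewrite /diff mulr0n addr0 subrr.
apply: deg_lt_ext (deg_ltD (deg_lt_shift (u *+ n) df) IHn) => x.
by rewrite /diff mulrSr !addrA subrK.
Qed.

(** The q-th iterated difference along u is the difference along [u *+ q = 0]. *)
Lemma deg_lt_pchar q u f : [pchar R].-nat q ->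
  (forall x, exists n, x = u *+ n) -> u *+ q = 0 -> deg_lt q f.
Proof.
move=> pq uM uq0; rewrite -[q]addn0; apply: deg_lt_cyclic uM _ => x.
by rewrite iter_diff_pchar // /diff uq0 addr0 subrr.
Qed.

End Cyclic.

(** On [nat], q differences along 1 amount to one along q, which acts on the dilated function as a
    difference along 1 acts on H. *)
Lemma deg_lt_dilate (R : comNzRingType) q d (H : nat -> R) :
  [pchar R].-nat q -> deg_lt d H ->
  deg_lt (q * d) (fun x => if (q %| x)%N then H (x %/ q)%N else 0).
Proof.
move=> pq; have q0 : (0 < q)%N by case/andP: pq.
elim: d H => [|d IHd] H dH.
  by rewrite muln0 => x; case: ifP.
have uN (x : nat) : exists n, x = 1%N *+ n by exists x; rewrite -[LHS]natn.
rewrite mulnS; apply: deg_lt_cyclic uN _.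
apply: deg_lt_ext (IHd _ (dH 1%N)) => x.
rewrite iter_diff_pchar // /diff.
have -> : 1%N *+ q = q by rewrite -[RHS]natn.
rewrite natrDE dvdn_addl // divnDr // divnn q0.
by case: ifP; rewrite ?subrr.
Qed.

(** * Zero-sum subsequences of lists *)

Section ZeroSumSub.
Variable G : finZmodType.
Implicit Types (s t u : seq G).

Definition zero_sum_sub l s :=
  exists t u, [/\ perm_eq s (t ++ u), size t = l & \sum_(x <- t) x = 0].

Lemma zero_sum_sub_perm l s s' :
  perm_eq s s' -> zero_sum_sub l s -> zero_sum_sub l s'.
Proof.
move=> ss' [t [u [stu szt t0]]]; exists t, u; split=> //.
by rewrite perm_sym in ss'; apply: perm_trans stu.
Qed.

Lemma zero_sum_sub_cat l s t : zero_sum_sub l s -> zero_sum_sub l (s ++ t).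
Proof.
move=> [t1 [u1 [st sz1 t0]]]; exists t1, (u1 ++ t); split=> //.
by rewrite catA perm_cat2r.
Qed.

Lemma zero_sum_sub_catr l s t : zero_sum_sub l t -> zero_sum_sub l (s ++ t).
Proof.
by move/(zero_sum_sub_cat s); apply: zero_sum_sub_perm; rewrite perm_catC.
Qed.

Lemma zero_sum_subD j l s t : size t = j -> \sum_(x <- t) x = 0 ->
  zero_sum_sub l s -> zero_sum_sub (j + l) (t ++ s).
Proof.
move=> szt t0 [t1 [u1 [st sz1 t10]]]; exists (t ++ t1), u1; split.
- by rewrite -catA perm_cat2l.
- by rewrite size_cat szt sz1.
- by rewrite big_cat /= t0 t10 addr0.
Qed.

Lemma zero_sum_sub_mask m s : size m = size s ->
  \sum_(x <- mask m s) x = 0 -> zero_sum_sub (size (mask m s)) s.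
Proof.
move=> szm m0; exists (mask m s), (mask (map negb m) s); split=> //.
elim: m s szm {m0} => [|[] m IHm] [|x s] //= [szm]; first by rewrite perm_cons IHm.
by rewrite perm_sym perm_catC /= perm_cons perm_catC perm_sym IHm.
Qed.

End ZeroSumSub.

Lemma zero_sum_sub_weight p q r L (H : nat -> 'F_p) (s : seq (cyclic_pow q r)) :
  prime p -> p.-nat q -> (0 < r)%N -> deg_lt (L - r) H ->
  (L * q - r <= size s)%N ->
  (forall j, (0 < j < L)%N -> zero_sum_sub (j * q) s -> H j = 0) -> H 0%N = 0.
Proof.
move=> pp pq r0 dH les H0.
have q0 : (0 < q)%N by case/andP: pq.
have pRq : [pchar 'F_p].-nat q.
  by apply: sub_in_pnat pq => l _ /eqP ->; rewrite pchar_Fp.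
case def_d: (L - r)%N dH => [|d] dH; first exact: dH.
(* With exactly L q - r < L q terms, a subsequence of length j q has j < L. *)
pose s1 := take (L * q - r) s.
have szs1 : size s1 = (L * q - r)%N by rewrite size_takel.
have {}H0 j : (0 < j < L)%N -> zero_sum_sub (j * q) s1 -> H j = 0.
  move=> jL zs1; apply: H0 => //; rewrite -(cat_take_drop (L * q - r) s).
  exact: zero_sum_sub_cat.
(* The second coordinate counts terms, so a subsequence sum also records its length. *)
pose M := (cyclic_pow q r * nat)%type.
pose ind (i : 'I_r) (x : M) : 'F_p := (x.1 ord0 i == 0)%:R.
pose gH (x : M) := if (q %| x.2)%N then H (x.2 %/ q)%N else 0.
pose f (x : M) := (\prod_(i <- enum 'I_r) ind i x) * gH x.
have dind i : deg_lt q.-1.+1 (ind i).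
  apply: (@deg_lt_comp _ _ M (fun x => x.1 ord0 i) q.-1.+1 (fun a => (a == 0)%:R)).
    by move=> x y; rewrite mxE.
  apply: (@deg_lt_pchar _ _ _ (inZp 1)); first by rewrite prednK.
    move=> a; exists a; rewrite Zp_mulrn; apply: val_inj => /=.
    by rewrite modnMml mul1n modn_small.
  by rewrite Zp_mulrn; apply: val_inj; rewrite /= prednK // modnMl.
(* The degree is less than r (q - 1) + q (L - r) = L q - r, the number of terms. *)
have df : deg_lt (size s1) f.
  have [e def_e] : exists e, (q * d.+1)%N = e.+1 
    by exists (q * d.+1).-1; rewrite prednK // muln_gt0 q0.
  have dg : deg_lt e.+1 gH.
    rewrite -def_e; apply: (@deg_lt_comp _ _ M snd) (deg_lt_dilate pRq dH).
    by move=> x y.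
  have := deg_ltM (deg_lt_prod (enum 'I_r) dind) dg.
  rewrite size_enum_ord; congr deg_lt.
  by rewrite szs1 -addnS -def_e; nia.
pose s2 : seq M := [seq (x, 1%N) | x <- s1].
have f0 : f 0 = H 0%N.
  rewrite /f /gH dvdn0 div0n big1 ?mul1r // => i _.
  by rewrite /ind mxE eqxx.
rewrite -f0; apply: (@deg_lt_eq0 _ _ s2) => [|m szm mt]; first by rewrite size_map.
have sum1 t : (\sum_(x <- [seq (y, 1%N) | y <- t]) x : M) = (\sum_(x <- t) x, size t).
  elim: t => [|y t IHt]; first by rewrite !big_nil.
  by rewrite /= !big_cons IHt.
rewrite -map_mask sum1 /f /gH /=.
case: ifP => [qd|]; last by rewrite mulr0.
set x0 := \sum_(x <- _) x; have [x00|x00] := eqVneq x0 0.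
  rewrite (H0 (size (mask m s1) %/ q)%N) ?mulr0 //; last first.
    by rewrite divnK //; apply: zero_sum_sub_mask; rewrite // szm size_map.
  have szm1 : size m = size s1 by rewrite szm size_map.
  have /andP[mt0 mtL] : (0 < size (mask m s1) <= size s1)%N.
    rewrite size_mask // -szm1 count_size andbT -has_count.
    by apply/hasP; exists true.
  rewrite divn_gt0 // ltn_divLR // dvdn_leq //=.
  by apply: leq_ltn_trans mtL _; rewrite szs1; nia.
have [i xi] : exists i, x0 ord0 i != 0.
  apply/existsP; apply: contraR x00; rewrite negb_exists => /forallP x00.
  by apply/eqP/rowP => i; rewrite mxE; apply/eqP; rewrite -[_ == _]negbK.
by rewrite (bigD1_seq i) ?mem_enum ?enum_uniq //= /ind /= (negPf xi) !mul0r.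
Qed.

(** * Sequences over powers of a cyclic p-group *)

Lemma zero_sum_sub_rem (G : finZmodType) j (s : seq G) : zero_sum_sub j s ->
  exists s' : seq G, size s = (j + size s')%N /\
    forall i, zero_sum_sub i s' -> zero_sum_sub i s /\ zero_sum_sub (j + i) s.
Proof.
move=> [t [u [stu szt t0]]]; exists u.
rewrite (perm_size stu) size_cat szt; split=> // i zu.
rewrite perm_sym in stu; split; apply: zero_sum_sub_perm stu _.
- exact: zero_sum_sub_catr.
- exact: zero_sum_subD.
Qed.

(** Inside a zero-sum [t], the complement of a zero-sum subsequence is zero-sum. The first term of
    [t] is kept out of [s'], so this complement is not empty. *)
Lemma zero_sum_sub_compl (G : finZmodType) j (s : seq G) :
  (0 < j)%N -> zero_sum_sub j s ->
  exists s' : seq G, size s' = j.-1 /\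
    forall i, zero_sum_sub i s' -> zero_sum_sub i s /\ zero_sum_sub (j - i) s.
Proof.
move=> j0 [t [u [stu szt t0]]]; rewrite -{}szt in j0 *.
exists (behead t); rewrite size_behead; split=> // i [t1 [u1 [tt1 sz1 t10]]].
case: t j0 stu t0 tt1 => //= x t _ stu t0 tt1.
have tE : perm_eq (x :: t) (t1 ++ x :: u1).
  by rewrite -cat_rcons -cats1 -catA perm_sym perm_catCA /= perm_cons perm_sym.
have stE : perm_eq s (t1 ++ (x :: u1) ++ u).
  by apply: perm_trans stu _; rewrite catA -cat_cons perm_cat2r.
split; first by exists t1, ((x :: u1) ++ u); split.
exists (x :: u1), (t1 ++ u); split.
- by apply: perm_trans stE _; rewrite perm_catCA.
- by have := perm_size tE; rewrite /= size_cat -sz1 /= => ->; rewrite addKn.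
- by move: t0; rewrite (perm_big _ tE) big_cat t10 /= add0r.
Qed.

Section PrimePower.
Variables (p q r : nat).
Hypotheses (pp : prime p) (pq : p.-nat q) (r0 : (0 < r)%N).
Implicit Types s : seq (cyclic_pow q r).

Let q0 : (0 < q)%N. Proof. by case/andP: pq. Qed.

(* The witness is [H j = \prod_(a <- A) (a - j)]. *)
Lemma zero_sum_sub_avoid L (A : seq nat) s :
  (size A < L - r)%N -> all (fun a => ~~ (p %| a)%N) A -> (L * q - r <= size s)%N ->
  exists j, [/\ (0 < j < L)%N, j \notin A & zero_sum_sub (j * q) s].
Proof.
move=> szA pA szs; apply: contrapT => noj.
have pF : p \in [pchar 'F_p] by rewrite pchar_Fp.
suff : \prod_(a <- A) (a%:R - 0%N%:R : 'F_p) = 0.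
  apply/eqP; rewrite prodf_seq_neq0; apply/allP => a /(allP pA).
  by rewrite subr0 (dvdn_pcharf pF).
apply: (zero_sum_sub_weight pp pq r0 _ szs (H := fun j => \prod_(a <- A) (a%:R - j%:R))).
- apply: (@deg_ltW _ _ (size A * 1).+1); first by rewrite muln1.
  apply: (@deg_lt_prod _ _ _ _ 1 (fun a j => a%:R - j%:R)) => a u v x.
  by rewrite /diff !natrD; ring.
move=> j jL zj; have jA : j \in A by apply: contrapT => /negP jA; case: noj; exists j.
by rewrite (big_rem j) //= subrr mul0r.
Qed.

Local Open Scope nat_scope.

Definition good k := forall s, ((k + r) * q - r <= size s)%N -> zero_sum_sub (k * q) s.

(** Removing k q terms from (k + l + r) q - r leaves the (l + r) q - r terms that [good l] asks
    for. *)
Lemma goodD k l : good k -> good l -> good (k + l).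
Proof.
move=> gk gl s szs.
have /zero_sum_sub_rem[s' [szs' s's]] : zero_sum_sub (k * q) s by apply: gk; nia.
by rewrite mulnDl; apply s's, gl; nia.
Qed.

Lemma good_ge k0 l k : 0 < l -> good l -> (forall i, i < l -> good (k0 + i)) ->
  k0 <= k -> good k.
Proof.
move=> l0 gl gk0; elim/ltn_ind: k => k IHk kk0.
have [kl|kl] := ltnP (k - k0) l; first by rewrite -(subnKC kk0); apply: gk0.
rewrite -(@subnK l k); last by lia.
by apply: goodD gl; apply: IHk; lia.
Qed.

Lemma good_pow t : (r <= p ^ t)%N -> good (p ^ t).
Proof.
move=> rt s szs; apply: contrapT => nz.
pose H (j : nat) : 'F_p := if (p ^ t %| j)%N then 1%R else 0%R.
suff /eqP : H 0 = 0%R by rewrite /H dvdn0 oner_eq0.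
apply: (zero_sum_sub_weight pp pq r0 _ szs) => [|j jL zj].
  rewrite addnK -[(p ^ t)%N]muln1.
  apply: (deg_lt_dilate _ (@deg_lt_cst nat 'F_p 1%R)).
  apply: (@sub_in_pnat p) => [l _ /eqP ->|]; first by rewrite pchar_Fp.
  by rewrite pnatX pnat_id.
rewrite /H; case: ifP => // /dvdnP[c def_j]; case: nz.
(* The bound 0 < j < p ^ t + r <= 2 p ^ t leaves only c = 1. *)
have c1 : c = 1%N by move: jL; rewrite def_j; nia.
by move: zj; rewrite def_j c1 mul1n.
Qed.

(* A derivation refutes the existence of a sequence of length at least [L q - r]
   without zero-sum subsequences of length [f q], for all [f] in a list [F].
   [Avoid l A] applies [zero_sum_sub_avoid] to [l <= L]; [Remove j] excludes the length
   [j q] by removing a zero-sum subsequence [T] of that length, and [Inside j] by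
   passing to [T]. The elements of [A] are prime to every [p >= 5]. *)
Inductive derivation :=
| Avoid of nat & seq nat
| Remove of nat & derivation & derivation
| Inside of nat & derivation & derivation.

Fixpoint refutes L (F : seq nat) D : bool :=
  match D with
  | Avoid l A => [&& (l <= L)%N, (size A < l - r)%N,
                   all (fun a => a \in [:: 1; 2; 3; 4; 6]%N) A
                 & all (fun j => j \in A ++ F) (iota 1 l.-1)]
  | Remove j D1 D2 =>
      refutes (L - j) (F ++ [seq (f - j)%N | f <- F & (j < f)%N]) D1
      && refutes L (j :: F) D2
  | Inside j D1 D2 =>
      [&& (0 < j)%N,
          refutes j (F ++ [seq (j - f)%N | f <- F & (f < j)%N]) D1
        & refutes L (j :: F) D2]
  end.

Hypothesis p5 : (5 <= p)%N.

(** A length f - j found after removing T gives f once T is put back; a length j - f found inside T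
    gives f by taking the complement in T. *)
Lemma refutesP L F D s : refutes L F D -> (L * q - r <= size s)%N ->
  exists2 f, f \in F & zero_sum_sub (f * q) s.
Proof.
elim: D L F s => [l A|j D1 IH1 D2 IH2|j D1 IH1 D2 IH2] L F s;
  rewrite [refutes _ _ _]/=.
- case/and4P=> lL szA /allP A6 /allP AF szs.
  have [||j [/andP[j0 jl] jA zj]] := @zero_sum_sub_avoid l A s szA.
  + apply/allP => a /A6; rewrite !inE orbA orbA orbA => /orP[a4|/eqP ->].
      by rewrite gtnNdvd //; lia.
    by rewrite (_ : 6 = 2 * 3) // Euclid_dvdM // !gtnNdvd //; lia.
  + by apply: leq_trans szs; rewrite leq_sub2r // leq_mul2r lL orbT.
  exists j => //; have := AF j; rewrite mem_iota mem_cat (negPf jA) /=.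
  by apply; lia.
- case/andP=> /IH1{}IH1 /IH2{}IH2 szs; have [f + zf] := IH2 _ szs.
  rewrite inE => /predU1P[def_f|]; last by exists f.
  rewrite {}def_f in zf; have [s' [szs' s's]] := zero_sum_sub_rem zf.
  have [|g + zg] := IH1 s'; first by rewrite mulnBl; lia.
  rewrite mem_cat => /orP[Fg|/mapP[h]]; first by exists g; last by case: (s's _ zg).
  rewrite mem_filter => /andP[jh Fh] def_g; exists h => //.
  by have [_] := s's _ zg; rewrite def_g -mulnDl subnKC // ltnW.
- case/and3P=> j0 /IH1{}IH1 /IH2{}IH2 szs; have [f + zf] := IH2 _ szs.
  rewrite inE => /predU1P[def_f|]; last by exists f.
  rewrite {}def_f in zf; have [|s' [szs' s's]] := zero_sum_sub_compl _ zf.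
    by rewrite muln_gt0 j0.
  have [|g + zg] := IH1 s'; first by rewrite szs'; lia.
  rewrite mem_cat => /orP[Fg|/mapP[h]]; first by exists g; last by case: (s's _ zg).
  rewrite mem_filter => /andP[hj Fh] def_g; exists h => //.
  by have [_] := s's _ zg; rewrite def_g -mulnBl subKn // ltnW.
Qed.

Lemma refutes_good k D : refutes (k + r) [:: k] D -> good k.
Proof.
by move=> kD s szs; have [f] := refutesP kD szs; rewrite inE => /eqP ->.
Qed.

End PrimePower.

Local Open Scope nat_scope.

(** * Multipliers for primes p >= 5 *)

Lemma good3_large p q k : prime p -> p.-nat q -> 5 <= p -> 6 <= k -> good q 3 k.
Proof.
move=> pp pq p5; have gD := @goodD p q 3 pp pq isT.
(* The lengths q and 5 q are excluded in turn; the remaining 2 q and 4 q are avoided by (2 - j) (4 -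
   j). *)
have g3 : good q 3 3.
  apply: (@refutes_good p q 3 pp pq isT p5 _
    (Remove 1 (Remove 1 (Avoid 4 [::]) (Avoid 4 [::]))
                (Inside 5 (Avoid 4 [::]) (Avoid 6 [:: 2; 4])))).
  by [].
(* The lengths q and 2 q are excluded in turn; below 5 q only 3 q remains besides the goal 4 q, and
   3 - j avoids it. *)
have g4 : good q 3 4.
  apply: (@refutes_good p q 3 pp pq isT p5 _
    (Remove 1 (Remove 1 (Avoid 5 [:: 1]) (Avoid 5 [:: 2]))
                (Remove 2 (Avoid 5 [:: 3]) (Avoid 5 [:: 3])))).
  by [].
refine (@good_ge p q 3 pp pq isT _ 3 k isT g3 _) => -[|[|[|//]]] _.
- exact: (gD _ _ g3 g3).
- exact: (gD _ _ g3 g4).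
- exact: (gD _ _ g4 g4).
Qed.

Lemma good4_large p q k : prime p -> p.-nat q -> 5 <= p -> 12 <= k -> good q 4 k.
Proof.
move=> pp pq p5; have gD := @goodD p q 4 pp pq isT.
(* The lengths q, 6 q, 2 q and 3 q are excluded in this order; with the goal 4 q, no length below 5
   q is left. *)
have g4 : good q 4 4.
  apply: (@refutes_good p q 4 pp pq isT p5 _
    (Remove 1 (Remove 2 (Avoid 5 [::]) (Remove 1 (Avoid 5 [::]) (Avoid 5 [::])))
         (Inside 6 (Avoid 6 [:: 3])
         (Remove 2 (Inside 5 (Avoid 5 [::]) (Avoid 6 [:: 3]))
         (Remove 3 (Avoid 5 [::]) (Avoid 5 [::])))))).
  by [].
(* Once q, 7 q and 3 q are excluded, (2 - j) (4 - j) (6 - j) avoids the lengths below 8 q other than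
   the goal 5 q. *)
have g5 : good q 4 5.
  apply: (@refutes_good p q 4 pp pq isT p5 _
    (Remove 1 (Remove 2 (Avoid 6 [:: 1]) (Remove 1 (Avoid 5 [::]) (Avoid 6 [:: 3])))
         (Inside 7 (Avoid 7 [:: 3; 4])
         (Remove 3 (Avoid 6 [:: 3]) (Avoid 8 [:: 2; 4; 6]))))).
  by [].
have g8 := gD _ _ g4 g4.
(* Each of 12, 13, 14, 15 is a sum of three terms equal to 4 or 5. *)
refine (@good_ge p q 4 pp pq isT _ 4 k isT g4 _) => -[|[|[|[|//]]]] _.
- exact: (gD _ _ g8 g4).
- exact: (gD _ _ g8 g5).
- exact: (gD _ _ g5 (gD _ _ g4 g5)).
- exact: (gD _ _ g5 (gD _ _ g5 g5)).
Qed.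

(** * Composite exponents *)

Local Open Scope ring_scope.

(** As f need not be injective, the permutation is carried back to s through positions. *)
Lemma zero_sum_sub_map (T : eqType) (G : finZmodType) (f : T -> G) l (s : seq T) :
  zero_sum_sub l [seq f x | x <- s] ->
  exists t u, [/\ perm_eq s (t ++ u), size t = l & \sum_(x <- t) f x = 0].
Proof.
case: s => [|x0 s'].
  by case=> [[|x t] [u [/perm_size]]] // _ <- _; exists [::], [::]; rewrite big_nil.
move: (x0 :: s') => s {s'} [t [u [fstu szt t0]]].
rewrite perm_sym in fstu; have /(perm_iotaP (f x0))[Is pIs tuE] := fstu.
pose s1 := [seq nth x0 s i | i <- Is].
have ss1 : perm_eq s s1.
  by rewrite perm_sym; apply/(perm_iotaP x0); exists Is; rewrite // -(size_map f).
have fs1 : [seq f x | x <- s1] = t ++ u.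
  rewrite tuE -map_comp; apply/eq_in_map => i.
  rewrite (perm_mem pIs) mem_iota size_map => /andP[_ lti] /=.
  by rewrite (nth_map x0).
exists (take l s1), (drop l s1); split.
- by rewrite cat_take_drop.
- rewrite size_takel // -(size_map f) fs1 size_cat szt; exact: leq_addr.
- by rewrite -(big_map f xpredT id) map_take fs1 take_size_cat.
Qed.

Lemma morph_sum0 (H K : zmodType) (f : H -> K) : {morph f : x y / x + y} ->
  forall (I : Type) (r : seq I) (F : I -> H),
    f (\sum_(i <- r) F i) = \sum_(i <- r) f (F i).
Proof.
move=> fD I r F; have f0 : f 0 = 0.
  by apply: (addrI (f 0)); rewrite -fD !addr0.
exact: (big_morph f fD f0).
Qed.

(* The groups [G1] and [G2] play the role of a quotient [G / K] and of [K]: blocks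
   of length [e] summing to zero in [G1] become the terms of a sequence over [G2]. *)
Section Blocks.
Variables (G G1 G2 : finZmodType) (phi : G -> G1) (iota : G2 -> G).
Hypotheses (phiD : {morph phi : x y / x + y}) (iotaD : {morph iota : x y / x + y}).
Hypothesis exact_phi : forall x, phi x = 0 -> exists y, x = iota y.
Variables (e t u l : nat).
Hypothesis zero_sum_G1 : forall s : seq G1, (t <= size s)%N -> zero_sum_sub e s.
Hypothesis zero_sum_G2 : forall s : seq G2, (u <= size s)%N -> zero_sum_sub l s.

(** Blocks are taken greedily: the last one needs t terms, each earlier one uses up e. The guard
    [0 < n] is for the truncated [n.-1]. *)
Lemma zero_sum_blocks n (s : seq G) : ((0 < n)%N -> (n.-1 * e + t <= size s)%N) ->
  exists (B : seq (seq G * G2)) (w : seq G),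
    [/\ perm_eq s (flatten [seq b.1 | b <- B] ++ w), size B = n &
        {in B, forall b, size b.1 = e /\ \sum_(x <- b.1) x = iota b.2}].
Proof.
elim: n s => [|n IHn] s szs; first by exists [::], s.
have [v [s' [svs' szv v0]]] : exists v s', [/\ perm_eq s (v ++ s'), size v = e &
    \sum_(x <- v) phi x = 0].
  by apply/zero_sum_sub_map/zero_sum_G1; rewrite size_map;
    exact: leq_trans (leq_addl _ _) (szs isT).
have [|B [w [sB szB BP]]] := IHn s'.
  by move=> n0; have := szs isT; rewrite (perm_size svs') size_cat szv /=
    -{1}(prednK n0) mulSn -addnA leq_add2l.
have [y vy] : exists y, \sum_(x <- v) x = iota y.
  by apply: exact_phi; rewrite (morph_sum0 phiD).
exists ((v, y) :: B), w; split=> /=; last first.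
- by move=> b; rewrite inE => /predU1P[-> //|/BP].
- by rewrite szB.
- by apply: perm_trans svs' _; rewrite -catA perm_cat2l.
Qed.

Lemma zero_sum_sub_blocks (s : seq G) :
  (u.-1 * e + t <= size s)%N -> zero_sum_sub (l * e) s.
Proof.
move=> szs; have [//|B  [w [sB szB BP]]] := @zero_sum_blocks u s.
have [B1 [B2 [B12 szB1 B10]]] : exists B1 B2, [/\ perm_eq B (B1 ++ B2), size B1 = l &
    \sum_(b <- B1) b.2 = 0].
  by apply/zero_sum_sub_map/zero_sum_G2; rewrite size_map szB.
have {}BP : {in B1, forall b, size b.1 = e /\ \sum_(x <- b.1) x = iota b.2}.
  by move=> b Bb; apply: BP; rewrite (perm_mem B12) mem_cat Bb.
exists (flatten [seq b.1 | b <- B1]), (flatten [seq b.1 | b <- B2] ++ w); split.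
- rewrite catA -flatten_cat -map_cat; apply: perm_trans sB _.
  by rewrite perm_cat2r perm_flatten // perm_map.
- rewrite size_flatten /shape -map_comp sumnE big_map -szB1.
  rewrite (eq_big_seq (fun=> e)) => [|b /BP[]//].
  by rewrite big_const_seq count_predT iter_addn_0 mulnC.
- rewrite big_flatten big_map (eq_big_seq (fun b => iota b.2)) => [|b /BP[]//].
  rewrite -(morph_sum0 iotaD) B10.
  by apply: (addrI (iota 0)); rewrite -iotaD !addr0.
Qed.
End Blocks.

(** The exact sequence is C_b^r -> C_(ab)^r -> C_a^r: multiplication by a, then reduction modulo
    a. *)
Lemma zero_sum_sub_cyclic_mul a b r e t u l : (0 < a)%N -> (0 < b)%N ->
  (forall s : seq (cyclic_pow a r), (t <= size s)%N -> zero_sum_sub e s) ->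
  (forall s : seq (cyclic_pow b r), (u <= size s)%N -> zero_sum_sub l s) ->
  forall s : seq (cyclic_pow (a * b) r),
    (u.-1 * e + t <= size s)%N -> zero_sum_sub (l * e) s.
Proof.
move=> a0 b0 Ha Hb s szs; have ab0 : (0 < a * b)%N by rewrite muln_gt0 a0.
pose phi (x : cyclic_pow (a * b) r) : cyclic_pow a r := map_mx (fun y => inZp (val y)) x.
pose iota (x : cyclic_pow b r) : cyclic_pow (a * b) r :=
  map_mx (fun y => inZp (a * val y)) x.
apply: (zero_sum_sub_blocks (phi := phi) (iota := iota) _ _ _ Ha Hb szs).
- move=> x y; apply/rowP => i; rewrite !mxE; move: (x _ i) (y _ i) => [m ?] [n ?].
  by apply: val_inj; rewrite /= !prednK // modn_dvdm ?dvdn_mulr // modnDm.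
- move=> x y; apply/rowP => i; rewrite !mxE; move: (x _ i) (y _ i) => [m ?] [n ?].
  by apply: val_inj; rewrite /= !prednK // muln_modr modn_mod modnDm mulnDr.
move=> x phix0; exists (map_mx (fun y => inZp (val y %/ a)) x).
apply/rowP => i; move/rowP/(_ i): phix0; rewrite !mxE.
move: (x _ i) => [m ltm] /(congr1 val) /=; rewrite prednK // => m0.
apply: val_inj; rewrite /= !prednK // in ltm *.
by rewrite muln_modr modn_mod mulnC divnK ?modn_small // /dvdn m0.
Qed.

(** * Caps over the field with three elements *)

Local Open Scope ring_scope.

(** Three distinct points of F_3^d form a line exactly when they sum to 0, and x + y + z = 0 with x
    = y forces z = x. So a cap is a set without lines. *)
Definition cap d (A : {set 'rV['F_3]_d}) : Prop :=
  {in A & A & A, forall x y z, x + y + z = 0 -> x = y}.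

Definition dot d (f w : 'rV['F_3]_d) : 'F_3 := \sum_i f ord0 i * w ord0 i.

Lemma dotDl d (f g w : 'rV['F_3]_d) : dot (f + g) w = dot f w + dot g w.
Proof. by rewrite -big_split; apply: eq_bigr => i _; rewrite mxE mulrDl. Qed.

Lemma dotDr d (f w v : 'rV['F_3]_d) : dot f (w + v) = dot f w + dot f v.
Proof. by rewrite -big_split; apply: eq_bigr => i _; rewrite mxE mulrDr. Qed.

Lemma dotNr d (f w : 'rV['F_3]_d) : dot f (- w) = - dot f w.
Proof. by rewrite -sumrN; apply: eq_bigr => i _; rewrite mxE mulrN. Qed.

Lemma dotZl d a (f w : 'rV['F_3]_d) : dot (a *: f) w = a * dot f w.
Proof. by rewrite mulr_sumr; apply: eq_bigr => i _; rewrite mxE mulrA. Qed.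

Lemma F3_mul3 d (x : 'rV['F_3]_d) : x + x + x = 0.
Proof.
apply/rowP => i; rewrite !mxE; case: (x ord0 i) => [[|[|[|//]]] ?]; exact: val_inj.
Qed.

Lemma sum_F3 (V : nmodType) (g : 'F_3 -> V) : \sum_a g a = g 0 + (g 1 + g (- 1)).
Proof.
rewrite !big_ord_recl big_ord0 addr0.
by congr (g _ + (g _ + g _)); apply: val_inj.
Qed.

Lemma card_rV3 d : #|{: 'rV['F_3]_d}| = (3 ^ d)%N.
Proof. by rewrite card_mx card_Fp // mul1n. Qed.

(** For w nonzero, the three fibres of the pairing with w are translates of each other by multiples
    of a vector e with [dot e w = 1]. *)
Lemma card_dot_eq0 d (w : 'rV['F_3]_d.+1) :
  #|[set f | dot f w == 0]| = (if w == 0%R then 3 ^ d.+1 else 3 ^ d)%N.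
Proof.
have [->|w0] := eqVneq w 0.
  rewrite -card_rV3 -cardsT; apply: eq_card => f; rewrite !inE /dot big1 // => i _.
  by rewrite mxE mulr0.
have [i wi] : exists i, w ord0 i != 0.
  apply/existsP; apply: contraR w0; rewrite negb_exists => /forallP w0.
  by apply/eqP/rowP => i; rewrite mxE; apply/eqP; rewrite -[_ == _]negbK.
pose e : 'rV['F_3]_d.+1 := (w ord0 i)^-1 *: delta_mx ord0 i.
have ew : dot e w = 1.
  rewrite /dot (bigD1 i) //= big1 => [|j /negPf ji].
    by rewrite !mxE !eqxx mulr1 mulVf ?addr0.
  by rewrite !mxE ji andbF mulr0 mul0r.
have eqc a : #|[set f | dot f w == a]| = #|[set f | dot f w == 0]|.
  rewrite -[RHS](card_imset _ (addrI (a *: e))); apply: eq_card => f; rewrite !inE.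
  apply/idP/imsetP => [/eqP fa|[g + ->]]; last first.
    by rewrite inE dotDl dotZl ew mulr1 => /eqP ->; rewrite addr0.
  exists (f - a *: e); last by rewrite addrC subrK.
  by rewrite inE -scaleNr dotDl dotZl fa ew mulr1 subrr.
apply/eqP; rewrite -(@eqn_pmul2l 3) // -expnS -card_rV3 -cardsT -[X in _ == X]sum1_card.
rewrite (partition_big (fun f => dot f w) predT) //=.
rewrite (eq_bigr (fun=> #|[set f | dot f w == 0]|)) => [|a _].
  by rewrite sum_nat_const card_Fp.
by rewrite -(eqc a) -sum1_card; apply: eq_bigl => f; rewrite !inE.
Qed.

Lemma dot_col'_eq0 d (f w : 'rV['F_3]_d.+1) i :
  f ord0 i != 0 -> dot f w = 0 -> col' i w = 0 -> w = 0.
Proof.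
move=> fi fw wi.
have wj j : j != i -> w ord0 j = 0.
  by move=> ji; case: (unliftP i j) ji => [k ->|->]; rewrite ?eqxx // => _;
     move/rowP/(_ k): wi; rewrite !mxE.
have wi0 : w ord0 i = 0.
  move: fw; rewrite /dot (bigD1 i) //= big1 => [|j ji]; last by rewrite wj ?mulr0.
  by rewrite addr0 => /eqP; rewrite mulf_eq0 (negPf fi) => /eqP.
by apply/rowP => j; rewrite mxE; have [->//|ji] := eqVneq j i; rewrite wj.
Qed.

(** Deleting a coordinate where f is nonzero is injective on the slice, and a zero sum of images
    lifts because the values of f add up to 3 a = 0. *)
Lemma cap_slice d M (A : {set 'rV['F_3]_d.+1}) (f : 'rV['F_3]_d.+1) a :
  (forall B : {set 'rV['F_3]_d}, cap B -> (#|B| <= M)%N) -> cap A -> f != 0 ->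
  (#|[set x in A | dot f x == a]| <= M)%N.
Proof.
move=> capM capA f0.
have [i fi] : exists i, f ord0 i != 0.
  apply/existsP; apply: contraR f0; rewrite negb_exists => /forallP f0.
  by apply/eqP/rowP => i; rewrite mxE; apply/eqP; rewrite -[_ == _]negbK.
rewrite -(card_in_imset (f := col' i)).
  apply: capM => _ _ _ /imsetP[x + ->] /imsetP[y + ->] /imsetP[z + ->].
  rewrite !inE => /andP[Ax /eqP xa] /andP[Ay /eqP ya] /andP[Az /eqP za] xyz.
  congr (col' i _); apply: (capA x y z) => //.
  apply: (dot_col'_eq0 fi); last by rewrite !linearD.
  rewrite !dotDr xa ya za; case: a {xa ya za} => [[|[|[|//]]] ?]; exact: val_inj.
move=> x y; rewrite !inE => /andP[_ /eqP xa] /andP[_ /eqP ya] xy.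
apply/eqP; rewrite -subr_eq0; apply/eqP/(dot_col'_eq0 fi).
  by rewrite dotDr dotNr xa ya subrr.
by rewrite linearB /= xy subrr.
Qed.

(* With [u_i = 3 n_i - N], summing to 0, the inequality reads
   [u_0 u_1 u_2 + mu (u_0^2 + u_1^2 + u_2^2) / 3 >= 0]. *)
Lemma cap_local (M N mu a b c : nat) :
  (a <= M -> b <= M -> c <= M -> a + b + c = N -> N + mu = 3 * M ->
  N * N * N + mu * (N * N) <=
  3 * (a * a * a + b * b * b + c * c * c + 6 * (a * b * c)) +
  mu * (3 * (a * a + b * b + c * c)))%N.
Proof.
move=> aM bM cM <- {N} defM.
have {}defM : mu%:Z = 3 * M%:Z - (a%:Z + b%:Z + c%:Z) by lia.
rewrite -lez_nat !(PoszD, PoszM) {mu}defM.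
move: aM bM cM; rewrite -!lez_nat.
move: (Posz a) (Posz b) (Posz c) (Posz M) => {a b c M} a b c M.
pose Q := a * a + b * b + c * c - a * b - b * c - c * a.
have Q0 : 0 <= Q.
  suff : 0 <= 2 * Q by rewrite pmulr_rge0.
  have -> : 2 * Q = (a - b) ^+ 2 + (b - c) ^+ 2 + (c - a) ^+ 2 by rewrite /Q; ring.
  by rewrite !addr_ge0 // sqr_ge0.
(* When z is at most the mean of x and y, the difference of the two sides is this sum of nonnegative
   terms; one of a, b, c can serve as z. *)
have key x y z : x <= M -> y <= M -> 2 * z <= x + y ->
    0 <= 3 * ((M - x) + (M - y)) * Q + 3 * (x + y - 2 * z) * (x - y) ^+ 2.
  move=> xM yM zxy; rewrite addr_ge0 // mulr_ge0 ?sqr_ge0 ?mulr_ge0 //; lia.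
move=> aM bM cM; rewrite -subr_ge0.
have [cab|cab] := lerP (2 * c) (a + b).
  by have := key _ _ _ aM bM cab; congr (is_true (0 <= _)); rewrite /Q; ring.
have [bca|bca] := lerP (2 * b) (c + a).
  by have := key _ _ _ cM aM bca; congr (is_true (0 <= _)); rewrite /Q; ring.
have abc : 2 * a <= b + c by lia.
by have := key _ _ _ bM cM abc; congr (is_true (0 <= _)); rewrite /Q; ring.
Qed.

Section CapStep.
Variables (d : nat) (A : {set 'rV['F_3]_d.+1}).
Local Notation N := #|A|.
Local Open Scope nat_scope.

Let n (f : 'rV['F_3]_d.+1) a := #|[set x in A | dot f x == a]|.
(** [pairs f] counts the pairs in A on which [dot f] agrees, [triples f] the triples with
    [dot f (x + y + z) = 0]. They stand in for moments of Fourier coefficients. *)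
Let pairs f := \sum_a n f a * n f a.
Let triples f := \sum_a \sum_b n f a * n f b * n f (- (a + b))%R.

Lemma sum_dot f (g : 'F_3 -> nat) : \sum_(x in A) g (dot f x) = \sum_a n f a * g a.
Proof.
rewrite (partition_big (dot f) predT) //=; apply: eq_bigr => a _.
rewrite (eq_bigr (fun=> g a)) => [|x /andP[_ /eqP -> //]].
by rewrite sum_nat_const; congr (_ * _); apply: eq_card => x; rewrite !inE.
Qed.

Lemma pairsE f : pairs f = \sum_(x in A) n f (dot f x).
Proof. by rewrite /pairs -(sum_dot f (n f)). Qed.

Lemma triplesE f :
  triples f = \sum_(x in A) \sum_(y in A) n f (- (dot f x + dot f y))%R.
Proof.
rewrite (eq_bigr (fun x => \sum_b n f b * n f (- (dot f x + b))%R)) => [|x _].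
  rewrite (sum_dot f (fun a => \sum_b n f b * n f (- (a + b))%R)).
  by apply: eq_bigr => a _; rewrite big_distrr; apply: eq_bigr => b _; rewrite /= mulnA.
by rewrite (sum_dot f (fun b => n f (- (dot f x + b))%R)).
Qed.

Lemma n_sum f a : n f a = \sum_(x in A) (dot f x == a).
Proof.
rewrite /n -sum1_card big_mkcond [RHS]big_mkcond; apply: eq_bigr => x _.
by rewrite inE; case: (x \in A); case: eqP.
Qed.

Lemma sum_dot_eq0 (w : 'rV['F_3]_d.+1) :
  \sum_f (dot f w == 0%R) = 3 ^ d + (w == 0%R) * (2 * 3 ^ d).
Proof.
transitivity #|[set f | dot f w == 0%R]|.
  by rewrite -sum1_card [RHS]big_mkcond; apply: eq_bigr => f _; rewrite inE; case: eqP.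
by rewrite card_dot_eq0; case: eqP => _; rewrite ?expnS; lia.
Qed.

Lemma sum_eq1 x : x \in A -> \sum_(y in A) (y == x) = 1.
Proof. by move=> Ax; rewrite (bigD1 x) //= eqxx big1 // => y /andP[_ /negPf ->]. Qed.

(** A pair is counted by all 3^(d+1) forms f if x = y, and by 3^d of them otherwise. *)
Lemma sum_pairs : \sum_f pairs f = N * N * 3 ^ d + 2 * (N * 3 ^ d).
Proof.
under eq_bigr => f _ do rewrite pairsE; rewrite exchange_big /=.
rewrite (eq_bigr (fun=> N * 3 ^ d + 2 * 3 ^ d)) => [|x Ax].
  by rewrite sum_nat_const; ring.
under eq_bigr => f _ do rewrite n_sum; rewrite exchange_big /=.
rewrite (eq_bigr (fun y => 3 ^ d + (y == x) * (2 * 3 ^ d))) => [|y Ay].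
  by rewrite big_split /= sum_nat_const -big_distrl /= sum_eq1 // mul1n.
rewrite -subr_eq0 -sum_dot_eq0; apply: eq_bigr => f _.
by rewrite dotDr dotNr subr_eq0.
Qed.

(** In a cap, x + y + z = 0 only if x = y = z; these N triples are counted by all 3^(d+1) forms, the
    others by 3^d. *)
Lemma sum_triples : cap A -> \sum_f triples f = N * N * N * 3 ^ d + 2 * (N * 3 ^ d).
Proof.
move=> capA.
under eq_bigr => f _ do rewrite triplesE; rewrite exchange_big /=.
rewrite (eq_bigr (fun=> N * N * 3 ^ d + 2 * 3 ^ d)) => [|x Ax].
  by rewrite sum_nat_const; ring.
rewrite exchange_big /= (eq_bigr (fun y => N * 3 ^ d + (y == x) * (2 * 3 ^ d))) => [|y Ay].
  by rewrite big_split /= sum_nat_const -big_distrl /= sum_eq1 // mul1n mulnA.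
under eq_bigr => f _ do rewrite n_sum; rewrite exchange_big /=.
rewrite (eq_bigr (fun z => 3 ^ d + (z == x) * ((y == x) * (2 * 3 ^ d)))) => [|z Az].
  by rewrite big_split /= sum_nat_const -big_distrl /= sum_eq1 // mul1n.
have -> : (z == x) * ((y == x) * (2 * 3 ^ d)) = (x + y + z == 0)%R * (2 * 3 ^ d).
  rewrite mulnA mulnb; congr (nat_of_bool _ * _).
  apply/andP/eqP => [[/eqP-> /eqP->]|xyz]; first exact: F3_mul3.
  have yx := capA x y z Ax Ay Az xyz; subst y; split=> //; apply/eqP.
  apply/esym/(capA x z x) => //.
  by rewrite addrAC.
rewrite -sum_dot_eq0; apply: eq_bigr => f _.
by rewrite !dotDr -[X in _ == X]add0r -subr_eq opprK addrC.
Qed.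

(** [cap_local] is summed over all nonzero f; the totals come from double counting, where f = 0
    contributes N^2 pairs and N^3 triples. *)
Lemma cap_step M :
  (forall B : {set 'rV['F_3]_d}, cap B -> #|B| <= M) -> cap A ->
  N * M + 3 ^ d * N <= 3 ^ d * (3 * M + 1).
Proof.
move=> capM capA.
have nM f a : f != 0%R -> n f a <= M by move=> f0; apply: cap_slice.
have sum_n f : n f 0%R + n f 1%R + n f (-1)%R = N.
  have := sum_dot f (fun=> 1); rewrite sum1_card sum_F3 !muln1 => ->.
  by rewrite !natrDE addnA.
have NM : N <= 3 * M.
  have f0 : const_mx 1%R != 0%R :> 'rV['F_3]_d.+1.
    by apply/eqP => /rowP/(_ ord0); rewrite !mxE.
  rewrite -(sum_n (const_mx 1%R)).
  by move: (nM _ 0%R f0) (nM _ 1%R f0) (nM _ (-1)%R f0); lia.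
pose mu := 3 * M - N; have defM : N + mu = 3 * M by rewrite subnKC.
have local f : f != 0%R ->
    N * N * N + mu * (N * N) <= 3 * triples f + mu * (3 * pairs f).
  move=> f0.
  have := cap_local (nM f 0%R f0) (nM f 1%R f0) (nM f (-1)%R f0) (sum_n f) defM.
  rewrite /pairs /triples !sum_F3 !natrDE.
  rewrite !(add0r, addr0, subrr, oppr0, opprK, addNr).
  have -> : (- (1 + 1) = 1 :> 'F_3)%R by apply: val_inj.
  have -> : (- (-1 - 1) = -1 :> 'F_3)%R by apply: val_inj.
  by congr (is_true (_ <= _)); ring.
have dot0 x : dot 0%R x = 0%R :> 'F_3.
  by rewrite /dot big1 // => i _; rewrite mxE mul0r.
have n00 : n 0%R 0%R = N.
  by apply: eq_card => x; rewrite inE dot0 eqxx andbT.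
have pairs0 : pairs 0%R = N * N.
  by rewrite pairsE; under eq_bigr do rewrite dot0 n00; rewrite sum_nat_const.
have triples0 : triples 0%R = N * N * N.
  rewrite triplesE (eq_bigr (fun=> N * N)) => [|x _]; first by rewrite sum_nat_const mulnA.
  rewrite (eq_bigr (fun=> N)) => [|y _]; first by rewrite sum_nat_const.
  by rewrite !dot0 addr0 oppr0 n00.
have := sum_pairs; rewrite (bigD1 0%R) //= pairs0 => S2.
have := sum_triples capA; rewrite (bigD1 0%R) //= triples0 => S3.
have : (3 ^ d.+1).-1 * (N * N * N + mu * (N * N)) <=
    3 * (\sum_(f | f != 0%R) triples f) + mu * (3 * (\sum_(f | f != 0%R) pairs f)).
  rewrite !big_distrr -big_split /= -card_rV3.
  by rewrite -(cardC1 0%R) -sum_nat_const leq_sum.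
have := expn_gt0 3 d; move: S2 S3; rewrite expnS.
move: (3 ^ d) (\sum_(_ | _) _) (\sum_(_ | _) _) => D P T S2 S3 /= D0 le.
have [->|N0] := posnP N; first by rewrite mul0n muln0.
move: (#|A|) defM N0 S2 S3 le => k defM k0 S2 S3; set X := _ + mu * (k * k) => le.
have sum_le : 3 * X + (3 * T + mu * (3 * P)) = 3 * (X * D) + 6 * (k * (D * (1 + mu))).
  transitivity (3 * (k * k * k + T) + 3 * mu * (k * k + P)); first by rewrite /X; ring.
  by rewrite S2 S3 /X; ring.
have XD : (3 * D).-1 * X + X = 3 * (X * D).
  by rewrite -[X in _ + X]mul1n -mulnDl addn1 prednK ?muln_gt0 // mulnCA mulnC mulnA.
have : 2 * X <= 6 * (k * (D * (1 + mu))) by lia.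
(* Cancelling 6 k leaves k M <= D (1 + mu), where 1 + mu + k = 3 M + 1. *)
have -> : X = k * k * (3 * M) by rewrite -defM /X; ring.
have -> : 2 * (k * k * (3 * M)) = 6 * (k * (k * M)) by ring.
rewrite !leq_pmul2l // => kM.
have -> : 3 * M + 1 = 1 + mu + k by rewrite -defM; ring.
by rewrite mulnDr leq_add2r.
Qed.

End CapStep.

(** Iterating N (M + 3^d) <= 3^d (3 M + 1) from M = 1 in dimension 0 gives 2, 4, 9. *)
Lemma cap_bound3 (A : {set 'rV['F_3]_3}) : cap A -> (#|A| <= 9)%N.
Proof.
have cap0 (B : {set 'rV['F_3]_0}) : cap B -> (#|B| <= 1)%N.
  by move=> _; apply: leq_trans (max_card _) _; rewrite card_rV3.
have cap1 (B : {set 'rV['F_3]_1}) : cap B -> (#|B| <= 2)%N.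
  by move/(cap_step cap0); lia.
have cap2 (B : {set 'rV['F_3]_2}) : cap B -> (#|B| <= 4)%N.
  by move/(cap_step cap1); lia.
by move/(cap_step cap2); lia.
Qed.

Lemma cap_bound4 (A : {set 'rV['F_3]_4}) : cap A -> (#|A| <= 21)%N.
Proof. by move/(cap_step cap_bound3); lia. Qed.

(** * The primes 2 and 3 *)

Local Open Scope nat_scope.

Lemma size_le_mul_card (T : finType) m (s : seq T) :
  (forall x, count_mem x s <= m) -> size s <= m * #|[set x in s]|.
Proof.
move=> sm; rewrite -sum1_size big_seq (partition_big id (mem [set x in s])) /= => [|x xs].
  rewrite mulnC -sum_nat_const leq_sum // => x _; rewrite sum1_count.
  by apply: leq_trans (sub_count _ _) (sm x) => y /andP[].
by rewrite inE.
Qed.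

Lemma zero_sum_sub_rep (G : finZmodType) e (x : G) s :
  e <= count_mem x s -> (x *+ e = 0)%R -> zero_sum_sub e s.
Proof.
move=> ex xe0; exists (nseq e x), (nseq (count_mem x s - e) x ++ filter (predC1 x) s).
split; first 1 last.
- by rewrite size_nseq.
- by rewrite big_nseq -[RHS]xe0 /GRing.natmul Monoid.iteropE.
rewrite catA -nseqD subnKC // perm_sym.
have -> : nseq (count_mem x s) x = filter (pred1 x) s.
  by rewrite -size_filter; apply/esym/all_pred1P/filter_all.
exact/permPl/perm_filterC.
Qed.

Lemma perm_cat_uniq (T : eqType) (t s : seq T) :
  uniq t -> {subset t <= s} -> exists u, perm_eq s (t ++ u).
Proof.
elim: t s => [|x t IHt] s /=; first by exists s.
move=> /andP[xt /IHt{}IHt] ts; have xs : x \in s by rewrite ts ?mem_head.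
have [y yt|u tu] := IHt (rem x s).
  have yx : y != x by apply: contraNneq xt => <-.
  have := ts y; rewrite inE yt orbT => /(_ isT).
  by rewrite (perm_mem (perm_to_rem xs)) inE (negPf yx).
by exists u; apply: perm_trans (perm_to_rem xs) _; rewrite perm_cons.
Qed.

Lemma zero_sum_sub2 r (s : seq (cyclic_pow 2 r)) : 2 ^ r < size s -> zero_sum_sub 2 s.
Proof.
move=> szs; have [x x2|s1] := pickP (fun x => 1 < count_mem x s).
  apply: (zero_sum_sub_rep x2); apply/rowP => i; rewrite mulmxnE mxE.
  by case: (x _ i) => [[|[|//]] ?]; apply: val_inj.
have {}s1 x : count_mem x s <= 1 by rewrite leqNgt s1.
have := size_le_mul_card s1; rewrite leqNgt mul1n => /negP[].
apply: leq_ltn_trans szs; apply: leq_trans (max_card _) _.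
by rewrite card_mx card_ord mul1n.
Qed.

(** If no element occurs three times, the support has more than M points, so it contains a line. *)
Lemma zero_sum_sub3 r M (s : seq (cyclic_pow 3 r)) :
  (forall A : {set 'rV['F_3]_r}, cap A -> #|A| <= M) ->
  2 * M < size s -> zero_sum_sub 3 s.
Proof.
move=> capM szs; have [x x3|s2] := pickP (fun x => 2 < count_mem x s).
  apply: (zero_sum_sub_rep x3); rewrite mulrSr mulr2n; exact: F3_mul3.
have {}s2 x : count_mem x s <= 2 by rewrite leqNgt s2.
apply: contrapT => ns.
have := leq_trans szs (size_le_mul_card s2); rewrite ltn_pmul2l // ltnNge => /negP[].
apply: (capM [set x : 'rV['F_3]_r | (x : cyclic_pow 3 r) \in s]) => x y z.
rewrite !inE => xs ys zs xyz0.
apply: contrapT => xy; apply: ns.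
have F3 (a b : 'rV['F_3]_r) : (a + a + b = 0 -> a = b)%R.
  by move=> aab; apply: (@addrI _ (a + a)%R); rewrite aab F3_mul3.
have uniq_xyz : uniq [:: x; y; z].
  rewrite /= !inE !andbT !negb_or; apply/andP; split; first (apply/andP; split).
  - exact/eqP.
  - by apply/eqP => xz; apply: xy; apply: F3; rewrite addrAC {2}xz.
  - by apply/eqP => yz; apply: xy; apply/esym/F3; rewrite {2}yz addrC addrA.
have [|w xyzw] := @perm_cat_uniq _ [:: x; y; z] s uniq_xyz.
  by move=> v; rewrite !inE => /or3P[] /eqP ->; [exact: xs | exact: ys | exact: zs].
exists [:: x; y; z], w; split=> //.
by rewrite !big_cons big_nil addr0 addrA.
Qed.

(** The bound reproduces itself: with P = p^a, A (P - 1) p + A (p - 1) + 1 = A (p P - 1) + 1. *)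
Lemma zero_sum_sub_short p r A :
  0 < p ->
  (forall s : seq (cyclic_pow p r), A * p.-1 < size s -> zero_sum_sub p s) ->
  forall a (s : seq (cyclic_pow (p ^ a) r)),
    A * (p ^ a).-1 < size s -> zero_sum_sub (p ^ a) s.
Proof.
move=> p0 Hp; elim=> [|a IHa].
  rewrite expn0 muln0 => -[//|x s] _; exists [:: x], s; split=> //.
  by rewrite big_seq1; apply/rowP => i; rewrite mxE; apply: val_inj; case: (x _ i) => -[].
rewrite expnS => s szs; rewrite [X in zero_sum_sub X _]mulnC.
have pa0 : 0 < p ^ a by rewrite expn_gt0 p0.
apply: (zero_sum_sub_cyclic_mul p0 pa0 Hp IHa).
apply: leq_trans szs; move: pa0; case: (p ^ a) => // P _.
by case: p p0 {Hp IHa s} => // p' _; rewrite !mulSn /=; lia.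
Qed.

Section Short.
Variables (p q r : nat).
Hypotheses (pp : prime p) (pq : p.-nat q) (r0 : 0 < r).

(** Since (k + 1 + r) q - r exceeds (k + 1 + r) (q - 1) >= A (q - 1), a zero-sum subsequence of
    length q can be removed before applying [good k]. *)
Lemma good_ge_short A k0 k : good q r k0 -> A <= k0 + r + 1 ->
  (forall s : seq (cyclic_pow p r), A * p.-1 < size s -> zero_sum_sub p s) ->
  k0 <= k -> good q r k.
Proof.
have p0 := prime_gt0 pp; have q0 : 0 < q by case/andP: pq.
move=> gk0 Ak0 /(zero_sum_sub_short p0) Hp.
have {}Hp (s : seq (cyclic_pow q r)) : A * q.-1 < size s -> zero_sum_sub q s.
  by case/p_natP: pq => // a def_q; rewrite def_q in s *; apply: Hp.
elim: k => [|k IHk]; first by rewrite leqn0 => /eqP <-.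
rewrite leq_eqVlt => /predU1P[<- //|k0k]; have gk := IHk k0k => s szs.
have /zero_sum_sub_rem[s' [szs' s's]] : zero_sum_sub q s.
  apply: Hp; apply: leq_trans szs.
  have : A * q.-1 <= (k.+1 + r) * q.-1 by rewrite leq_mul2r; apply/orP; right; lia.
  by move: q0; case: (q) => // q' _; rewrite mulnS /=; lia.
by rewrite mulSn; apply s's, gk; nia.
Qed.

End Short.

Lemma good3 p q k : prime p -> p.-nat q -> 6 <= k -> good q 3 k.
Proof.
move=> pp pq k6; have [p5|] := leqP 5 p; first exact: good3_large p5 k6.
case: p pp pq => [|[|[|[|[|p]]]]] // _ pq _.
(* For p = 2 the bound A = 2^3 equals 4 + 3 + 1. *)
- have g4 : good q 3 4 by apply: (@good_pow 2 q 3 isT pq isT 2).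
  by refine (@good_ge_short 2 q 3 isT pq isT 8 4 k g4 isT _ _);
    [apply: zero_sum_sub2 | lia].
- have g3 : good q 3 3 by apply: (@good_pow 3 q 3 isT pq isT 1).
  have g6 := @goodD 3 q 3 isT pq isT 3 3 g3 g3.
  refine (@good_ge_short 3 q 3 isT pq isT 9 6 k g6 isT _ k6) => s szs.
  by apply: (zero_sum_sub3 cap_bound3); rewrite mulnC.
Qed.

Lemma good4 p q k : prime p -> p.-nat q -> 18 <= k -> good q 4 k.
Proof.
move=> pp pq k18; have [p5|] := leqP 5 p.
  by apply: good4_large p5 _ => //; lia.
case: p pp pq => [|[|[|[|[|p]]]]] // _ pq _.
- have g16 : good q 4 16 by apply: (@good_pow 2 q 4 isT pq isT 4).
  by refine (@good_ge_short 2 q 4 isT pq isT 16 16 k g16 isT _ _);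
    [apply: zero_sum_sub2 | lia].
(* For p = 3, 9 + 4 + 1 is below the cap bound 21, so the start is 18 = 9 + 9. *)
- have g9 : good q 4 9 by apply: (@good_pow 3 q 4 isT pq isT 2).
  have g18 := @goodD 3 q 4 isT pq isT 9 9 g9 g9.
  refine (@good_ge_short 3 q 4 isT pq isT 21 18 k g18 isT _ k18) => s szs.
  by apply: (zero_sum_sub3 cap_bound4); rewrite mulnC.
Qed.

(** * Bounds on the constants *)

Lemma has_zero_sum_subseqP (G : finZmodType) l (S : {mset G}%mset) :
  has_zero_sum_subseq l S <-> zero_sum_sub l S.
Proof.
split=> [[T [TS szT T0]]|[t [u [stu szt t0]]]].
  exists T, (S `\` T)%mset; split=> //; apply/allP => x _.
  rewrite /= count_cat !count_mem_mset msetE2 subnKC //.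
  exact: (msubsetP TS).
have pt := perm_eq_seq_mset t.
exists (seq_mset t); split.
- apply/msubsetP => x; rewrite mset_seqE -[S x]count_mem_mset.
  by rewrite (seq.permP stu) count_cat leq_addr.
- by rewrite (perm_size pt).
- by rewrite (perm_big _ pt).
Qed.

Lemma s_const_zero_sum_sub n r k (s : seq (cyclic_pow n r)) : 0 < n -> 0 < r ->
  s_const (cyclic_pow n r) k <= size s -> zero_sum_sub (k * n) s.
Proof.
move=> n0 r0 szs; have [[_ sP] _] := s_constP (cyclic_pow n r) k.
have ps := perm_eq_seq_mset s.
apply: (zero_sum_sub_perm ps); apply/has_zero_sum_subseqP.
rewrite -[X in _ * X](exponent_cyclic_pow n0 r0).
by apply: sP; rewrite (perm_size ps).
Qed.

Lemma s_const_le n r k t : 0 < n -> 0 < r -> 0 < t ->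
  (forall s : seq (cyclic_pow n r), t <= size s -> zero_sum_sub (k * n) s) ->
  s_const (cyclic_pow n r) k <= t.
Proof.
move=> n0 r0 t0 tP; have [_] := s_constP (cyclic_pow n r) k; apply; split=> // S szS.
by apply/has_zero_sum_subseqP; rewrite exponent_cyclic_pow //; apply: tP.
Qed.

(** Blocks of length n come from the constant of C_n^r; their sums form a sequence over C_q^r. *)
Lemma s_const_mul_le q n r k : 0 < q -> 0 < n -> 0 < r -> good q r k ->
  s_const (cyclic_pow (n * q) r) k
    <= ((k + r) * q - r).-1 * n + s_const (cyclic_pow n r) 1.
Proof.
move=> q0 n0 r0 gk; have [[s0 _] _] := s_constP (cyclic_pow n r) 1.
apply: s_const_le => //; first by rewrite muln_gt0 n0.
  by rewrite addn_gt0 s0 orbT.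
move=> s szs; have -> : k * (n * q) = k * q * n by ring.
apply: (zero_sum_sub_cyclic_mul n0 q0 _ gk szs) => s1 szs1.
by rewrite -[X in zero_sum_sub X _]mul1n; apply: s_const_zero_sum_sub.
Qed.

(** In the list of all elements of C_2^r no two terms sum to 0, since x + y = 0 means x = y. *)
Lemma s_const2_gt r : 0 < r -> 2 ^ r < s_const (cyclic_pow 2 r) 1.
Proof.
move=> r0; rewrite ltnNge; apply/negP => le_s.
have [|t [u [stu szt t0]]] := @s_const_zero_sum_sub 2 r 1 (enum (cyclic_pow 2 r)) isT r0.
  by rewrite -cardE card_mx card_ord mul1n.
have : uniq (t ++ u) by rewrite -(perm_uniq stu) enum_uniq.
case: t szt t0 {stu} => [|x [|y [|]]] //= _; rewrite !big_cons big_nil addr0 => xy.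
rewrite inE negb_or => /andP[/andP[/eqP[]]].
apply/rowP => i; move/rowP/(_ i): xy; rewrite !mxE.
case: (x _ i) (y _ i) => [[|[|//]] ?] [[|[|//]] ?] /(congr1 val) //= _; exact: val_inj.
Qed.

(** * The largest prime power divisor *)

Section MaxPrimePower.
Variable n : nat.
Hypothesis n1 : 1 < n.

Lemma max_prime_power_ge q : prime_power q -> q %| n -> q <= max_prime_power n.
Proof.
move=> qP qn; apply: (leq_bigmax_seq (F := id)); last exact/asboolP.
by rewrite -dvdn_divisors // ltnW.
Qed.

Lemma max_prime_power_gt1 : 1 < max_prime_power n.
Proof.
apply: leq_trans (prime_gt1 (pdiv_prime n1)) _; apply: max_prime_power_ge (pdiv_dvd n).
by exists (pdiv n), 1; rewrite pdiv_prime.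
Qed.

Lemma max_prime_power_dvd : max_prime_power n %| n.
Proof.
(* The value 0 is that of an empty maximum. *)
suff : (max_prime_power n == 0) || (max_prime_power n %| n).
  by have := max_prime_power_gt1; case: (max_prime_power n).
rewrite /max_prime_power big_seq_cond.
apply: (@big_ind _ (fun q => (q == 0) || (q %| n))) => // [x y|q /andP[+ _]].
  by rewrite /maxn; case: ifP.
by rewrite -dvdn_divisors => [->|]; rewrite ?orbT // ltnW.
Qed.

Lemma le_max_prime_power : n <= max_prime_power n ^ omega n.
Proof.
have n0 : 0 < n by apply: ltnW.
rewrite {1}[n]prod_prime_decomp // prime_decompE big_map /= big_seq.
apply: (@leq_trans (\prod_(p <- primes n) max_prime_power n)); last first.
  by rewrite big_const_seq count_predT -Monoid.iteropE.
rewrite [leqRHS]big_seq; apply: leq_prod => p; rewrite -logn_gt0 => p0.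
apply: max_prime_power_ge; last exact: pfactor_dvdnn.
by exists p, (logn p n); split=> //; move: p0; rewrite logn_gt0 mem_primes => /andP[].
Qed.

End MaxPrimePower.

Section Bound.
Variables (R : realType) (c : R) (hc : alon_dubiner_constant c).
Local Open Scope ring_scope.

(** The Alon-Dubiner bound for n = 2, against s(C_2^r) > 2^r >= 2 r. *)
Lemma a_const_ge0 r : (2 <= r)%N -> 0 <= a_const c r.
Proof.
move=> r2; rewrite /a_const subr_ge0; case: hc => _ /(_ 2 r isT r2).
set X := _ ^+ r => leX; rewrite -(@ler_pM2r _ 2) //; apply: le_trans leX.
rewrite -natrM ler_nat; have := @s_const2_gt r (ltnW r2).
apply: leq_trans; apply: ltnW; rewrite ltnS mulnC.
by case: r r2 {X} => // r _; rewrite expnS leq_pmul2l // ltn_expl.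
Qed.

(** Taking m-th roots in n <= M^m gives n^(1/m) <= M. *)
Lemma powR_quot_ge (m n M : nat) : (0 < n)%N -> (0 < m)%N -> (0 < M)%N ->
  (n <= M ^ m)%N -> (M %| n)%N -> (n %/ M)%:R <= n%:R `^ (1 - m%:R^-1) :> R.
Proof.
move=> n0 m0 M0 nM Mn.
have n0R : 0 < n%:R :> R by rewrite ltr0n.
have nm0 : 0 < n%:R `^ m%:R^-1 :> R by rewrite powR_gt0.
rewrite -(ler_pM2r nm0) -powRD ?(gt_eqF n0R) ?implybT // subrK powRr1 ?ler0n //.
rewrite -{3}(divnK Mn) natrM ler_wpM2l ?ler0n //.
have : n%:R `^ m%:R^-1 <= (M%:R ^+ m) `^ m%:R^-1 :> R.
  by apply: ge0_ler_powR; rewrite ?nnegrE ?invr_ge0 ?ler0n -?natrX ?ler_nat ?ler0n.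
move=> /le_trans; apply; rewrite -powR_mulrn ?ler0n // -powRrM.
by rewrite divff ?powRr1 ?ler0n // pnatr_eq0 -lt0n.
Qed.

(** With n' = n / q, the - r n' from the length over C_q^r cancels the r n' in s(C_n'^r) <= (a_r +
    r) n', which leaves a_r n'. *)
Lemma s_const_bound n r m k : (1 < n)%N -> (2 <= r)%N -> omega n = m -> (0 < m)%N ->
  good (max_prime_power n) r k ->
  (s_const (cyclic_pow n r) k)%:R
    <= (k%:R + r%:R) * n%:R + a_const c r * n%:R `^ (1 - m%:R^-1).
Proof.
move=> n1 r2 omn m0 gk; set q := max_prime_power n in gk *.
have r0 : (0 < r)%N by apply: ltnW.
have n0 : (0 < n)%N by apply: ltnW.
have q1 : (1 < q)%N := max_prime_power_gt1 n1.
have q0 : (0 < q)%N by apply: ltnW.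
have qn : (q %| n)%N := max_prime_power_dvd n1.
have nqm : (n <= q ^ m)%N by rewrite -omn; apply: le_max_prime_power.
have nq : n = (n %/ q * q)%N by rewrite divnK.
have n'0 : (0 < n %/ q)%N by rewrite divn_gt0 // dvdn_leq.
have := s_const_mul_le q0 n'0 r0 gk; rewrite -nq.
rewrite -(ler_nat R) => /le_trans; apply.
rewrite natrD natrM.
have [_ /(_ (n %/ q)%N r n'0 r2)] := hc.
have -> : (c * r%:R * log2 r%:R) ^+ r = a_const c r + r%:R by rewrite subrK.
move=> les; have a0 := a_const_ge0 r2; have := powR_quot_ge n0 m0 q0 nqm qn.
move: (n%:R `^ _) => y n'y.
have leN : ((((k + r) * q - r).-1 + r)%N <= (k + r) * q)%N by nia.
have {}leN : ((k + r) * q - r).-1%:R + r%:R <= (k%:R + r%:R) * q%:R :> R.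
  by rewrite -!natrD -natrM ler_nat.
have -> : n%:R = (n %/ q)%:R * q%:R :> R by rewrite -natrM -nq.
apply: le_trans (lerD (lexx _) les) _.
rewrite mulrDl addrCA -mulrDl addrC mulrA [_ * (n %/ q)%:R * _]mulrAC.
by apply: lerD; [apply: ler_wpM2r; rewrite ?ler0n | apply: ler_wpM2l].
Qed.

End Bound.

Lemma max_prime_powerP n : 1 < n -> exists2 p, prime p & p.-nat (max_prime_power n).
Proof.
move=> n1; have [_ [p [a [_ [pp defM _ _ _]]]]] := p_const_exists 0 n1.
by exists p; rewrite // defM pnatX pnat_id.
Qed.

Lemma good_p_const n r k : 1 < n -> 0 < r ->
  0 < k -> good (max_prime_power n) r (k * p_const n r).
Proof.
move=> n1 r0 k0.
have [[p [a [t [pp defM t0 defq rt]]]] _] := leastP (p_const_exists r n1).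
have -> : p_const n r = p ^ t := defq.
rewrite defq in rt.
have pM : p.-nat (max_prime_power n) by rewrite defM pnatX pnat_id.
have gpt := good_pow pp pM r0 rt.
elim: k k0 => // -[|k] IHk _; first (rewrite mul1n; exact gpt).
by rewrite mulSn; apply: (goodD pp pM r0 gpt); apply: IHk.
Qed.

Local Open Scope ring_scope.

Theorem theorem4p5 (R : realType) (c : R) (hc : alon_dubiner_constant c)
    (n r m : nat) (hn : (0 < n)%N) (hr : (0 < r)%N) (hm : (0 < m)%N)
    (hnm : omega n = m) :
  [/\
      forall k : nat, (6 <= k)%N ->
        (s_const (cyclic_pow n 3) k)%:R
          <= (k%:R + 3) * n%:R + a_const c 3 * n%:R `^ (1 - m%:R^-1),
      forall k : nat, (18 <= k)%N ->
        (s_const (cyclic_pow n 4) k)%:R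
          <= (k%:R + 4) * n%:R + a_const c 4 * n%:R `^ (1 - m%:R^-1)
    &
      (5 <= r)%N -> forall k : nat, (0 < k)%N ->
        (s_const (cyclic_pow n r) (k * p_const n r))%:R
          <= ((k * p_const n r)%:R + r%:R) * n%:R
             + a_const c r * n%:R `^ (1 - m%:R^-1)].
Proof.
(* The number 1 has no prime divisor, so m > 0 rules it out. *)
have n1 : (1 < n)%N by move: n hn hnm hm => [|[|n]] //= _ <-.
have [p pp pM] := max_prime_powerP n1.
split=> [k k6|k k18|r5 k k0].
- by apply: (s_const_bound hc n1) => //; apply: good3 pp pM k6.
- by apply: (s_const_bound hc n1) => //; apply: good4 pp pM k18.
- by apply: (s_const_bound hc n1) => //; [lia | apply: good_p_const].
Qed.
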